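(* Assume that $X[\mathcal{T}]$ is a locally convex topological vector space, $\mathcal{C}$ is a non-decreasing countable localizing family in $X$, and each member of $\mathcal{C}$ is $\mathcal{T}$-compact. The following hold. (A) The localization of $\mathcal{T}$ by $\mathcal{C}$ is $\mathcal{T}_{\mathcal{C}}=\{E\subseteq X:E\cap C\in\mathcal{T}|_C\text{ for every }C\in\mathcal{C}\}$. (B) For every set $E\subseteq X$: (a) $E$ is $\mathcal{T}_{\mathcal{C}}$-open if and only if $E\cap C$ is $\mathcal{T}|_C$-open for every $C\in\mathcal{C}$; (b) $E$ is $\mathcal{T}_{\mathcal{C}}$-closed if and only if $E\cap C$ is $\mathcal{T}|_C$-closed for every $C\in\mathcal{C}$. (C) A set $B\subseteq X$ is $\mathcal{T}_{\mathcal{C}}$-bounded if and only if it is contained in some $C\in\mathcal{C}$. (D) $X[\mathcal{T}_{\mathcal{C}}]$ is sequentially complete.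
   Context: All vector spaces are real; topological vector spaces are Hausdorff. $X[\mathcal{T}]$ denotes $X$ equipped with the topology $\mathcal{T}$; $\mathcal{T}|_C=\{E\cap C:E\in\mathcal{T}\}$. A localizing family in a vector space $X$ is a non-empty collection $\mathcal{C}$ of convex subsets of $X$ containing $0$ such that for all $C\in\mathcal{C}$, $x\in X$, $t\in\mathbb{R}$ there is $D\in\mathcal{C}$ with $x+t\cdot C\subseteq D$. It is non-decreasing countable if it can be numbered $\mathcal{C}=\{C_k:k\in\mathbb{N}\}$ with $C_k\subseteq C_{k+1}$ for all $k$. Given a locally convex topology $\mathcal{T}$ on $X$ and a localizing family $\mathcal{C}$, the localization $\mathcal{T}_{\mathcal{C}}$ is the locally convex vector topology on $X$ consisting of all $E\subseteq X$ such that for every $x\in E$ there is a convex $V$ with $x\in V\subseteq E$ and $V\cap C\in\mathcal{T}|_C$ for every $C\in\mathcal{C}$. *)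

(* Defs.v *)
From HB Require Import structures.
From mathcomp Require Import all_boot all_order all_algebra.
From mathcomp Require Import all_classical all_reals all_analysis.
From mathcomp Require Import ring lra.
Import Order.TTheory GRing.Theory Num.Theory.
Import numFieldNormedType.Exports.

Set Implicit Arguments.
Unset Strict Implicit.
Unset Printing Implicit Defensive.

Local Open Scope classical_set_scope.
Local Open Scope ring_scope.

Definition trace_open (T : topologicalType) (C : set T) : set_system T :=
  [set E `&` C | E in open].

(* Closed sets of the space [C] with its trace topology: complements are taken
   relative to [C]. *)
Definition trace_closed (T : topologicalType) (C : set T) : set_system T :=
  [set F | F `<=` C /\ trace_open C (C `\` F)].

Record localizing_family (R : realType) (X : lmodType R)
    (CC : set_system X) : Prop := LocalizingFamily {
  localizing_nonempty : CC !=set0 ;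
  localizing_convex : forall C, CC C -> convex_set C ;
  localizing_zero : forall C, CC C -> C 0 ;
  localizing_affine : forall C (x : X) (t : R), CC C ->
    exists2 D, CC D & [set x + t *: y | y in C] `<=` D }.

Definition nondecreasing_countable (T : Type) (CC : set_system T) : Prop :=
  exists C : nat -> set T,
    CC = range C /\ (forall k, C k `<=` C k.+1).

Definition localization (R : realType) (X : tvsType R)
    (CC : set_system X) : set_system X :=
  [set E | forall x, E x -> exists V : set X,
    [/\ convex_set V, V x, V `<=` E &
        forall C, CC C -> trace_open C (V `&` C)]].

(* The vector space [X] with the topology [localization CC]; it is made into a
   locally convex [tvsType] below. *)
Definition localized (R : realType) (X : tvsType R) (CC : set_system X)
  of localizing_family CC : Type := X.

Definition tvs_bounded (R : realType) (E : tvsType R) (B : set E) : Prop :=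
  forall U : set E, nbhs 0 U ->
    exists2 r : R, 0 < r & forall t : R, r < t -> B `<=` [set t *: y | y in U].

Definition sequentially_complete (T : uniformType) : Prop :=
  forall u : nat -> T, cauchy (u @ \oo) -> exists l : T, u @ \oo --> l.

Lemma convex_set_comb (R : realType) (X : lmodType R) (V : set X) x y (a b : R) :
  convex_set V -> V x -> V y -> 0 <= a -> 0 <= b -> a + b = 1 ->
  V (a *: x + b *: y).
Proof.
move=> cV Vx Vy a0 b0 ab1.
have a1 : a <= 1 by rewrite -ab1 lerDl.
have i01a : Itv.spec (@Itv.num_sem R) (Itv.Real `[0%Z, 1%Z]) a.
  by apply/and3P; split; rewrite ?num_real ?in_itv //= ?bnd_simp /= ?a0 ?a1.
have : V (a *: x + (1 - a) *: y).
  exact: (set_mem (cV x y (Itv.Def i01a) (mem_set Vx) (mem_set Vy))).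
by rewrite -ab1 addrAC subrr add0r.
Qed.

Section localized_tvs.
Context (R : realType) (X : tvsType R) (CC : set_system X)
  (CCloc : localizing_family CC).

Notation Y := (localized CCloc).

Let locally_open (V : set X) := forall C, CC C -> trace_open C (V `&` C).

Let locally_openI : setI_closed locally_open.
Proof.
move=> V W oV oW C CC_C.
have [Q oQ QV] := oV _ CC_C; have [Q' oQ' QW] := oW _ CC_C.
exists (Q `&` Q'); first exact: openI.
by rewrite [RHS]setIIl -QV -QW setIIl.
Qed.

Let localizationT : localization CC setT.
Proof.
move=> x _; exists setT; split => //.
by move=> C _; exists setT; [exact: openT|].
Qed.

Let localizationI : setI_closed (localization CC).
Proof.
move=> E F oE oF x [/oE[V [cV Vx VE oV]] /oF[W [cW Wx WF oW]]].
exists (V `&` W); split => //; last 2 first.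
- exact: setISS.
- exact: locally_openI.
- move=> y z l /set_mem[Vy Wy] /set_mem[Vz Wz]; apply/mem_set; split.
  + by apply/set_mem/cV; exact: mem_set.
  + by apply/set_mem/cW; exact: mem_set.
Qed.

Let localization_bigcup (I : Type) (f : I -> set X) :
  (forall i, localization CC (f i)) -> localization CC (\bigcup_i f i).
Proof.
move=> of_ x [i _ /of_[V [cV Vx Vf oV]]]; exists V; split => //.
by move=> y /Vf fy; exists i.
Qed.

HB.instance Definition _ := GRing.Lmodule.on Y.
HB.instance Definition _ := isOpenTopological.Build Y
  localizationT localizationI localization_bigcup.

Lemma localized_openE : (open : set_system Y) = localization CC.
Proof. by []. Qed.

Let nbhs_locally_open (x : Y) (V : set X) :
  convex_set V -> locally_open V -> V x -> nbhs x (V : set Y).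
Proof.
move=> cV oV Vx; apply: open_nbhs_nbhs; split; last exact: Vx.
rewrite localized_openE => y Vy; exists V.
by split; [exact: cV|exact: Vy| |exact: oV].
Qed.

Let nbhsP (x : Y) (U : set Y) : nbhs x U ->
  exists V : set X, [/\ convex_set V, locally_open V, V x & V `<=` U].
Proof.
rewrite nbhsE => -[E [/= oE Ex] EU].
move: oE; rewrite localized_openE => /(_ _ Ex)[V [cV Vx VE oV]].
by exists V; split => //; exact: subset_trans EU.
Qed.

Let affine_continuous (x : X) (t : R) : continuous (fun y : X => x + t *: y).
Proof.
move=> y; apply: (@continuous_comp X (X * X)%type X (fun y => (x, t *: y))
  (fun z : X * X => z.1 + z.2)); last exact: add_continuous.
apply: (@cvg_pair _ _ _ _ (nbhs x)); first exact: cvg_cst.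
apply: (@continuous_comp X (R^o * X)%type X (fun y => (t, y))
  (fun z : R^o * X => z.1 *: z.2)); last exact: scale_continuous.
by apply: (@cvg_pair _ _ _ _ (nbhs (t : R^o))); [exact: cvg_cst|exact: cvg_id].
Qed.

Let line_continuous (x y : X) : continuous (fun s : R^o => x + s *: y).
Proof.
move=> s; apply: (@continuous_comp R^o (X * X)%type X (fun s => (x, s *: y))
  (fun z : X * X => z.1 + z.2)); last exact: add_continuous.
apply: (@cvg_pair _ _ _ _ (nbhs x)); first exact: cvg_cst.
apply: (@continuous_comp R^o (R^o * X)%type X (fun s => (s, y))
  (fun z : R^o * X => z.1 *: z.2)); last exact: scale_continuous.
by apply: (@cvg_pair _ _ _ _ (nbhs (s : R^o))); [exact: cvg_id|exact: cvg_cst].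
Qed.

Let locally_open_affine (V : set X) (x : X) (t : R) :
  locally_open V -> locally_open [set y | V (x + t *: y)].
Proof.
move=> oV C CC_C; have [D CC_D sub] := localizing_affine CCloc x t CC_C.
have [Q oQ QV] := oV _ CC_D.
exists [set y | Q (x + t *: y)].
  by apply: open_comp oQ => y _; exact: affine_continuous.
apply/seteqP; split => y /= [+ Cy].
- have Dy : D (x + t *: y) by apply: sub; exists y.
  move=> Qy; split => //.
  by have : (Q `&` D) (x + t *: y) by []; rewrite QV => -[].
- have Dy : D (x + t *: y) by apply: sub; exists y.
  move=> Vy; split => //.
  by have : (V `&` D) (x + t *: y) by []; rewrite -QV => -[].
Qed.

Let convex_affine (V : set X) (x : X) (t : R) :
  convex_set V -> convex_set [set y | V (x + t *: y)].
Proof.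
move=> cV y z l /set_mem /= Vy /set_mem /= Vz; apply/mem_set => /=.
have l0 : 0 <= l%:num by exact: ge0.
have l1 : 0 <= 1 - l%:num by rewrite subr_ge0; exact: le1.
have := convex_set_comb cV Vy Vz l0 l1 (subrKC _ _).
congr V; rewrite /conv /= !scalerDr !scalerA !(mulrC t) addrACA.
by rewrite -scalerDl subrKC scale1r.
Qed.

Let mid_sum (V : set X) (a b z w : X) : convex_set V ->
  V (b - a + 2 *: z) -> V (a - b + 2 *: w) -> V (z + w).
Proof.
move=> cV Vz Vw.
have := convex_set_comb (a := 2^-1) (b := 2^-1) cV Vz Vw.
have -> : 2^-1 *: (b - a + 2 *: z) + 2^-1 *: (a - b + 2 *: w) = z + w.
  rewrite -scalerDr addrACA -[a - b]opprB subrr add0r -scalerDr scalerA mulVf //.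
  by rewrite scale1r.
by apply; lra.
Qed.

Let double_sub (a b : X) : b - a + 2 *: a = a + b.
Proof. by rewrite scaler_nat mulr2n addrA subrK addrC. Qed.

Let localized_add_continuous : continuous (fun x : Y * Y => x.1 + x.2).
Proof.
move=> [a b] U /nbhsP[V [cV oV Vab VU]].
pose aX : X := a; pose bX : X := b.
have Vab' : V (aX + bX) by exact: Vab.
exists ([set z : X | V (bX - aX + 2 *: z)], [set z : X | V (aX - bX + 2 *: z)]).
  split; apply: nbhs_locally_open.
  - exact: convex_affine.
  - exact: locally_open_affine.
  - by rewrite -double_sub in Vab'; exact: Vab'.
  - exact: convex_affine.
  - exact: locally_open_affine.
  - by rewrite addrC -double_sub in Vab'; exact: Vab'.
by move=> [z w] /= [Vz Vw]; apply: VU; exact: mid_sum Vz Vw.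
Qed.

Let line_nbhs (V : set X) (x y : X) :
  convex_set V -> locally_open V -> V x ->
  \forall s \near (0 : R^o), V (x + s *: y).
Proof.
move=> cV oV Vx.
have [C0 CC0] := localizing_nonempty CCloc.
have [D1 CD1 s1] := localizing_affine CCloc y 1 CC0.
have [D2 CD2 s2] := localizing_affine CCloc (- y) 2 CD1.
have [D3 CD3 s3] := localizing_affine CCloc x 1 CD2.
have D1y : D1 y.
  by apply: s1; exists 0; rewrite ?scaler0 ?addr0 //; exact: localizing_zero CC0.
have D2y : D2 y.
  by apply: s2; exists y => //; rewrite scaler_nat mulr2n addrA addNr add0r.
have D2Ny : D2 (- y).
  by apply: s2; exists 0; rewrite ?scaler0 ?addr0 //; exact: localizing_zero CD1.
have D3s (s : R) : -1 <= s -> s <= 1 -> D3 (x + s *: y).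
  move=> sN1 s1'.
  have D2s : D2 (((1 + s) / 2) *: y + ((1 - s) / 2) *: (- y)).
    by apply: convex_set_comb (localizing_convex CCloc CD2) _ _ _ _ _; rewrite //; lra.
  apply: s3; eexists; first exact: D2s.
  rewrite scale1r scalerN -scalerBl; congr (_ + _ *: _). by field.
have [Q oQ QV] := oV _ CD3.
have Qx : Q x.
  have : (V `&` D3) x.
    by split => //; have := D3s 0; rewrite scale0r addr0; apply; lra.
  by rewrite -QV => -[].
have : \forall s \near (0 : R^o), Q (x + s *: y).
  apply: (line_continuous (x := x) (y := y) (x0 := 0)).
  by rewrite scale0r addr0; exact: open_nbhs_nbhs.
move=> nO; have n1 : \forall s \near (0 : R^o), `|s| <= 1.
  exact: (nbhs0_le ltr01).
near=> s.
have s1' : `|s| <= 1 by near: s.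
have : (Q `&` D3) (x + s *: y).
  split; first by near: s.
  by move: s1'; rewrite ler_norml => /andP[? ?]; exact: D3s.
by rewrite QV => -[].
Unshelve. all: by end_near. Qed.

Let convex_comb_line (a b c : R) (p y z : X) : a + b = 1 ->
  a *: (p - c *: y + c *: z) + b *: (p - (- c) *: y + (- c) *: z) =
  p + ((a - b) * c) *: (z - y).
Proof.
move=> ab1; rewrite -!(addrA p) ![- _ + _]addrC -!scalerBr !scalerDr.
rewrite !scalerN -!scalerBr !scalerA addrACA -!scalerDl ab1 scale1r.
by congr (_ + _ *: _); ring.
Qed.

Let half_sum (t t0 : R) (x x0 : X) :
  2^-1 *: (t0 *: x0 + (2 * (t - t0)) *: x0) +
  2^-1 *: (t0 *: x0 + (2 * t) *: (x - x0)) = t *: x.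
Proof.
rewrite -scalerDr scalerBr !addrA -scalerDl -scalerDl addrAC -scalerBl.
rewrite scalerDr !scalerA (_ : _ * (_ + _ + _ - _) = 0); last by field.
by rewrite scale0r add0r; congr (_ *: _); field.
Qed.

Let localized_scale_continuous : continuous (fun z : R^o * Y => z.1 *: z.2).
Proof.
move=> [t0 y0] U /nbhsP[V [cV oV Vx VU]].
pose x0 : X := y0; pose p : X := t0 *: x0.
have Vp : V p by exact: Vx.
pose M : R := `|t0| + 1.
have M0 : 0 < M by rewrite ltr_wpDl.
have nT : \forall t \near (t0 : R^o), V (p + (2 * (t - t0)) *: x0).
  have n0 : \forall s \near (0 : R^o), V (p + s *: (2 *: x0)).
    exact: line_nbhs.
  apply/nbhs0P; apply: filterS n0 => e /=.
  by rewrite scalerA mulrC addrAC subrr add0r.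
have nM : \forall t \near (t0 : R^o), `|t| <= M.
  apply/nbhs0P; apply: filterS (nbhs0_le ltr01) => e e1.
  by apply: le_trans (ler_normD _ _) _; rewrite lerD2l.
pose W (c : R) : set Y := [set x : X | V (p - c *: x0 + c *: x)].
have nW c : nbhs y0 (W c).
  apply: nbhs_locally_open; [exact: convex_affine|exact: locally_open_affine|].
  by rewrite -(subrK (c *: x0) p) in Vp; exact: Vp.
exists ([set t | V (p + (2 * (t - t0)) *: x0) /\ `|t| <= M],
        W (2 * M) `&` W (- (2 * M))).
  by split; [exact: (filterI nT nM)|exact: (filterI (nW _) (nW _))].
move=> [t x] /= [[Vt tM] [W1 WN1]]; apply: VU.
pose xX : X := x.
have /andP[tM1 tM2] : - M <= t <= M by rewrite -ler_norml.
have Vtx : V (p + (2 * t) *: (xX - x0)).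
  have a0 : 0 <= (1 + t / M) / 2.
    have : -1 <= t / M by rewrite ler_pdivlMr // mulN1r.
    by move=> ?; lra.
  have b0 : 0 <= (1 - t / M) / 2.
    have : t / M <= 1 by rewrite ler_pdivrMr // mul1r.
    by move=> ?; lra.
  have ab1 : (1 + t / M) / 2 + (1 - t / M) / 2 = 1 by field; rewrite gt_eqF.
  have := convex_set_comb cV W1 WN1 a0 b0 ab1.
  rewrite convex_comb_line //; congr (V (_ + _ *: _)).
  by field; rewrite gt_eqF.
have := convex_set_comb (a := 2^-1) (b := 2^-1) cV Vt Vtx.
rewrite half_sum; apply; lra.
Qed.

Let localized_locally_convex :
  exists2 B : set_system Y, (forall b, b \in B -> convex_set b) & basis B.
Proof.
exists [set V | convex_set (V : set X) /\ locally_open V].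
  by move=> V /set_mem[cV _]; exact: cV.
split.
  move=> V [cV oV]; rewrite -/(open V) localized_openE => x Vx.
  by exists V; split; [exact: cV|exact: Vx| |exact: oV].
move=> x U /nbhsP[V [cV oV Vx VU]]; exists V => //.
Qed.

(* This factory only provides the uniform structure; the other mixins of [Tvs]
   have to be given explicitly. *)
HB.instance Definition _ := PreTopologicalLmod_isTvs.Build R Y
  localized_add_continuous localized_scale_continuous localized_locally_convex.
HB.instance Definition _ := PreTopologicalNmodule_isTopologicalNmodule.Build Y
  localized_add_continuous.
HB.instance Definition _ := TopologicalNmodule_isTopologicalLmodule.Build R Y
  localized_scale_continuous.
HB.instance Definition _ := Uniform_isTvs.Build R Y localized_locally_convex.

(* The uniform structure of [Y], hence the meaning of [cauchy] in [Y], is the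
   one induced by its vector topology. *)
Lemma localized_entourageE (A : set (Y * Y)) :
  entourage A <-> exists U : set Y,
    nbhs (0 : Y) U /\ forall xy : Y * Y, U (xy.1 - xy.2) -> A xy.
Proof.
split=> -[U [U0 UA]]; exists U; split => // xy.
  by move=> Uxy; apply/set_mem/UA/mem_set.
by move=> /set_mem Uxy; apply/mem_set/UA.
Qed.

Lemma open_localization (E : set X) : open E -> localization CC E.
Proof.
move=> oE x Ex; have [B cB [oB nB]] := @locally_convex R X.
have [b [Bb bx] bE] := nB x E (open_nbhs_nbhs (conj oE Ex)).
exists b; split => //; first by apply: cB; exact: mem_set.
by move=> C _; exists b => //; exact: oB.
Qed.

Lemma localized_hausdorff : hausdorff_space X -> hausdorff_space Y.
Proof.
rewrite !open_hausdorff => hX x y xy.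
have [[A B] /= [xA yB] [oA oB AB]] := hX x y xy.
by exists (A, B) => //=; split => //; exact: open_localization.
Qed.

End localized_tvs.

(* Main.v *)
Require Import Defs.
From HB Require Import structures.
From mathcomp Require Import all_boot all_order all_algebra.
From mathcomp Require Import all_classical all_reals all_analysis.
Import Order.TTheory GRing.Theory Num.Theory.
Import numFieldNormedType.Exports.

Set Implicit Arguments.
Unset Strict Implicit.
Unset Printing Implicit Defensive.

Local Open Scope classical_set_scope.
Local Open Scope ring_scope.

(* The point is (A): a set [E] whose traces on the compact convex sets
   C_0 <= C_1 <= ... are all open contains, around each of its points [x], a
   convex set with open traces. Starting from {x}, a convex set whose closure
   lies in the trace of [E] on [C_n] can be enlarged, by adding a small convex
   neighbourhood of 0 and intersecting with [C_(n+1)], to a convex set with the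
   same property at level n + 1; the union of this chain is the required set.
   Since the localized topology has the trace topologies on each [C_n], members
   of the family are bounded, and conversely a set that escapes every multiple
   of every [C_n] yields a sequence whose complement is open by (A) and does not
   absorb it. A Cauchy sequence is bounded, hence lies in a compact [C_n], and a
   Cauchy sequence with a cluster point converges to it. *)

(** * Convex sets, trace topologies and Cauchy filters *)

Lemma convex_set_of_comb (R : realType) (X : lmodType R) (V : set X) :
  (forall x y (a b : R), V x -> V y -> 0 <= a -> 0 <= b -> a + b = 1 ->
    V (a *: x + b *: y)) -> convex_set V.
Proof.
move=> cV x y l /set_mem Vx /set_mem Vy; apply/mem_set.
by apply: cV; rewrite ?subr_ge0 ?ge0 ?le1 ?subrKC.
Qed.

Lemma trace_openS (T : topologicalType) (C D V : set T) :
  C `<=` D -> trace_open D (V `&` D) -> trace_open C (V `&` C).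
Proof.
move=> CD [Q oQ QV]; exists Q => //.
by rewrite -(setIidr CD) !setIA QV.
Qed.

Lemma trace_closedC (T : topologicalType) (C E : set T) :
  trace_closed C (E `&` C) <-> trace_open C (~` E `&` C).
Proof.
have CE : C `\` (E `&` C) = ~` E `&` C.
  by rewrite setDIr setDv setU0 setDE setIC.
rewrite /trace_closed /= CE; by split=> [[]//|oE]; split => //; exact: subIsetr.
Qed.

(** The filter has members [P], [Q] whose product lies in [B]; since [P] meets the [B]-neighbourhood
    of [p], all of [Q] is within two [B]-steps of [p]. *)
Lemma cauchy_cluster_cvg (T : uniformType) (F : set_system T) (p : T) :
  ProperFilter F -> cauchy F -> cluster F p -> F --> p.
Proof.
move=> PF cF clF; apply/cvg_entourageP => A entA.
have [B entB BA] := entourage_split_ex entA.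
have [[P Q] /= [FP FQ] PQ] := cF _ entB.
have [y [Py /xsectionP By]] := clF P _ FP (nbhs_entourage p entB).
by apply: filterS FQ => x Qx; apply: BA; exists y => //; exact: (PQ (y, x)).
Qed.

(** * Compact and convex sets in a locally convex space *)

Section tvs.
Context (R : realType) (X : tvsType R).
Implicit Types (C D E K Q U V W : set X) (x y z : X).

(** Continuity of addition handles each [y] locally; the near-covering form of compactness makes the
    range of [w] uniform over [K]. *)
Lemma near0_add_sub K Q : compact K -> open Q -> K `<=` Q ->
  \forall w \near (0 : X), forall y, K y -> Q (y + w).
Proof.
move=> /compact_near_coveringP cK oQ KQ.
apply: (cK X (nbhs 0) (fun w y => Q (y + w))) => y /KQ Qy.
apply: (@add_continuous X (y, 0)); rewrite /= addr0.
exact: open_nbhs_nbhs.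
Qed.

Lemma near0_scale_sub K Q : compact K -> nbhs 0 Q ->
  \forall s \near (0 : R^o), forall y, K y -> Q (s *: y).
Proof.
move=> /compact_near_coveringP cK Q0.
apply: (cK R^o (nbhs 0) (fun s y => Q (s *: y))) => y _.
have /= := @scale_continuous R X (0, y) Q.
rewrite scale0r => /(_ Q0)[[A B] [/= A0 By] AB].
by exists (B, A) => // -[z s] [/= Bz As]; exact: (AB (s, z)).
Qed.

Lemma nbhs0_convex_split W : nbhs 0 W -> exists U,
  [/\ open U, convex_set U, U 0 & forall x y, U x -> U y -> W (x + y)].
Proof.
have /= := @add_continuous X (0, 0) W.
rewrite addr0 => + W0 => /(_ W0)[[A B] [/= A0 B0] AB].
have [S cS [oS nS]] := @locally_convex R X.
have [U [SU U0] UAB] := nS 0 _ (filterI A0 B0).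
exists U; split => //; [exact: oS|by apply: cS; exact: mem_set|].
by move=> x y /UAB[Ax _] /UAB[_ By]; exact: (AB (x, y)).
Qed.

Lemma subr_continuousl z : continuous (fun y : X => y - z).
Proof.
move=> y; apply: (@continuous_comp X (X * X)%type X (fun y => (y, - z))
  (fun z : X * X => z.1 + z.2)); last exact: add_continuous.
by apply: (@cvg_pair _ _ _ _ (nbhs y)); [exact: cvg_id|exact: cvg_cst].
Qed.

Lemma subr_continuousr z : continuous (fun y : X => z - y).
Proof.
move=> y; apply: (@continuous_comp X (X * X)%type X (fun y => (z, y))
  (fun z : X * X => z.1 - z.2)); last exact: sub_continuous.
by apply: (@cvg_pair _ _ _ _ (nbhs z)); [exact: cvg_cst|exact: cvg_id].
Qed.

(* The closure of [Q `&` D] stays in [E], so the construction can be iterated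
   along an increasing sequence of sets [D]. *)
Lemma convex_fatten E D K :
  hausdorff_space X -> compact D -> convex_set D -> trace_open D (E `&` D) ->
  convex_set K -> closure K `<=` E `&` D ->
  exists Q, [/\ open Q, K `<=` Q, convex_set (Q `&` D) &
    closure (Q `&` D) `<=` E `&` D].
Proof.
move=> hX cD convD [P oP PE] convK KED.
have cK : compact (closure K).
  apply: subclosed_compact (@closed_closure _ _) cD _.
  by move=> y /KED[].
have KP : closure K `<=` P by move=> y /KED; rewrite -PE => -[].
(* One copy of [U] is spent on enlarging [K] to [K + U], the other on passing to the closure. *)
have [U [oU convU U0 UU]] := nbhs0_convex_split (near0_add_sub cK oP KP).
have cQ : convex_set [set y | exists2 z, K z & U (y - z)].
  apply: convex_set_of_comb => x y a b [x' Kx' Ux] [y' Ky' Uy] a0 b0 ab1.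
  exists (a *: x' + b *: y'); first exact: convex_set_comb.
  by rewrite opprD addrACA -!scalerBr; exact: convex_set_comb.
exists [set y | exists2 z, K z & U (y - z)]; split.
- rewrite (_ : mkset _ = \bigcup_(z in K) [set y | U (y - z)]).
    apply: bigcup_open => z _; apply: open_comp oU => y _.
    exact: subr_continuousl.
  by apply/seteqP; split => y [z Kz Uz]; exists z.
- by move=> y Ky; exists y => //; rewrite subrr.
- apply: convex_set_of_comb => x y a b [Qx Dx] [Qy Dy] a0 b0 ab1.
  by split; exact: convex_set_comb.
- move=> y clQy; have Dy : D y.
    have /closure_id -> := compact_closed hX cD.
    exact: closure_subset clQy.
  have nUy : nbhs y [set w | U (y - w)].
    apply: subr_continuousr; rewrite subrr; exact: open_nbhs_nbhs.
  have [w [[[z Kz Uwz] _] Uyw]] := clQy _ nUy.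
  rewrite -PE; split => //.
  have -> : y = z + ((y - w) + (w - z)) by rewrite (addrA (y - w)) subrK subrKC.
  exact: UU (subset_closure Kz).
Qed.

(* The union of the convex sets [K n.+1 = Q n `&` C n.+1] works: each [K n] is
   contained in [Q n], hence in the relative interior of [K n.+1] in [C n.+1]. *)
Lemma convex_locally_open_sub (C : nat -> set X) E x :
  hausdorff_space X -> (forall k, compact (C k)) ->
  (forall k, convex_set (C k)) -> (forall k, C k `<=` C k.+1) ->
  (forall k, trace_open (C k) (E `&` C k)) -> E x -> C 0%N x ->
  exists V, [/\ convex_set V, V x, V `<=` E &
    forall k, trace_open (C k) (V `&` C k)].
Proof.
move=> hX cC convC ndC oE Ex Cx.
(* The hypotheses stand inside the existential so that choice yields a total function; where they
   fail, [setT] is a dummy value. *)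
have step (p : nat * set X) : exists Q, convex_set p.2 ->
    closure p.2 `<=` E `&` C p.1 -> [/\ open Q, p.2 `<=` Q,
      convex_set (Q `&` C p.1.+1) &
      closure (Q `&` C p.1.+1) `<=` E `&` C p.1.+1].
  have [[cp clp]|np] := pselect (convex_set p.2 /\ closure p.2 `<=` E `&` C p.1).
    have [|Q Qp] := convex_fatten hX (cC p.1.+1) (convC _) (oE _) cp.
      by apply: subset_trans clp _; apply: setIS.
    by exists Q.
  by exists setT => cp clp; exfalso; apply: np.
have {step}[f fP] := choice step.
pose K n := iteri n (fun n L => f (n, L) `&` C n.+1) [set x].
have KP n : convex_set (K n) /\ closure (K n) `<=` E `&` C n.
  elim: n => [|n [cK clK]]; last by have [] := fP (n, K n) cK clK.
  split=> [|y].
    apply: convex_set_of_comb => _ _ a b -> -> _ _ ab1 /=.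
    by rewrite -scalerDl ab1 scale1r.
  have /closure_id <- : closed [set x].
    exact/accessible_closed_set1/hausdorff_accessible.
  by move=> ->.
pose Q n := f (n, K n).
have QP n : [/\ open (Q n), K n `<=` Q n & K n.+1 = Q n `&` C n.+1].
  by have [cK clK] := KP n; have [] := fP (n, K n) cK clK.
have KC n : K n `<=` E `&` C n by move=> y /subset_closure; exact: (KP n).2.
have ndK n m : (n <= m)%N -> K n `<=` K m.
  move=> /subnK <-; elim: (m - n)%N => // d IH y /IH Ky.
  have [_ KQ ->] := QP (d + n)%N; split; first exact: KQ.
  by apply: ndC; exact: (KC _ _ Ky).2.
exists (\bigcup_n K n); split.
- apply: convex_set_of_comb => y z a b [n _ Kny] [m _ Kmz] a0 b0 ab1.
  exists (maxn n m) => //; apply: convex_set_comb => //; first exact: (KP _).1.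
    exact: ndK (leq_maxl _ _) _ Kny.
  exact: ndK (leq_maxr _ _) _ Kmz.
- by exists 0%N.
- by move=> y [n _ /KC[]].
(* For [n >= k], [Q n] meets [C k] inside [K n.+1]; conversely each [K n] lies in [Q (maxn n k)]. *)
- move=> k; exists (\bigcup_(n in [set n | (k <= n)%N]) Q n).
    by apply: bigcup_open => n _; have [] := QP n.
  have ndCk n : (k <= n)%N -> C k `<=` C n.
    by move=> /subnK <-; elim: (n - k)%N => // d IH y /IH; exact: ndC.
  apply/seteqP; split => y [[n kn Qy] Cy]; split => //.
    exists n.+1 => //; have [_ _ ->] := QP n; split => //.
    by apply: ndCk Cy; exact: leqW.
  exists (maxn n k); first exact: leq_maxr.
  by have [_ + _] := QP (maxn n k); apply; exact: ndK (leq_maxl _ _) _ Qy.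
Qed.

End tvs.

Lemma convex_scaleV (R : realType) (X : lmodType R) (V : set X) y (t : R) :
  convex_set V -> V 0 -> V y -> 1 <= t -> V (t^-1 *: y).
Proof.
move=> cV V0 Vy t1; have t0 : 0 < t by exact: lt_le_trans t1.
have tV1 : t^-1 <= 1 by rewrite invf_le1.
have := convex_set_comb (a := t^-1) (b := 1 - t^-1) cV Vy V0.
by rewrite scaler0 addr0 subr_ge0 invr_ge0 subrKC ltW //; apply.
Qed.

(** * Open and closed sets of the localized topology *)

Section localized.
Context (R : realType) (X : tvsType R) (CC : set_system X)
  (hX : hausdorff_space X) (CCloc : localizing_family CC)
  (CCcount : nondecreasing_countable CC)
  (CCcompact : forall C, CC C -> compact C).

Notation Y := (localized CCloc).

Lemma localizing_sequence : exists C : nat -> set X,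
  [/\ forall k, CC (C k), forall D, CC D -> exists k, C k = D &
      forall k m, (k <= m)%N -> C k `<=` C m].
Proof.
have [C [-> ndC]] := CCcount; exists C; split; first by move=> k; exists k.
  by move=> D [k _ <-]; exists k.
by move=> k m /subnK <-; elim: (m - k)%N => // d IH y /IH; exact: ndC.
Qed.

Lemma localizing_cover x : exists2 C, CC C & C x.
Proof.
have [C CC_C] := localizing_nonempty CCloc.
have [D CC_D sub] := localizing_affine CCloc x 0 CC_C.
exists D => //; apply: sub; exists 0; first exact: (localizing_zero CCloc).
by rewrite scale0r addr0.
Qed.

Lemma localization_trace_open (E C : set X) :
  localization CC E -> CC C -> trace_open C (E `&` C).
Proof.
move=> oE CC_C.
(* This is the largest open set whose trace on [C] lies in [E]. *)
exists (\bigcup_(Q in [set Q | open Q /\ Q `&` C `<=` E]) Q).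
  by apply: bigcup_open => Q [].
apply/seteqP; split => x [+ Cx].
  by move=> [Q [_ QE] Qx]; split => //; exact: QE.
move=> /oE[V [_ Vx VE oV]]; split => //.
have [Q oQ QV] := oV _ CC_C; exists Q.
  by split => //; rewrite QV; apply: subset_trans VE; exact: subIsetl.
by have : (V `&` C) x by []; rewrite -QV => -[].
Qed.

Lemma localization_compactE :
  localization CC = [set E | forall C, CC C -> trace_open C (E `&` C)].
Proof.
apply/seteqP; split=> E oE; first by move=> C; exact: localization_trace_open.
move=> x Ex; have [C [CC_C CCE hC]] := localizing_sequence.
have [_ /CCE[k0 <-] Cx] := localizing_cover x.
(* The sequence is shifted by [k0] because the construction starts from a point of its first
   member. *)
have [|||||//|V [cV Vx VE oV]] :=
  @convex_locally_open_sub R X (fun k => C (k + k0)%N) E x hX.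
- by move=> k; exact: CCcompact.
- by move=> k; exact: (localizing_convex CCloc).
- by move=> k; exact: hC.
- by move=> k; exact: oE.
- by [].
exists V; split=> // _ /CCE[k <-].
by apply: trace_openS (oV k); exact/hC/leq_addr.
Qed.

Lemma localized_openP (E : set Y) :
  open E <-> forall C, CC C -> trace_open C (E `&` C).
Proof. by rewrite (localized_openE CCloc) localization_compactE. Qed.

Lemma localized_closedP (E : set Y) :
  closed E <-> forall C, CC C -> trace_closed C (E `&` C).
Proof.
rewrite -openC localized_openP.
by split=> H C CC_C; apply/trace_closedC; exact: H.
Qed.

Lemma localized_nbhs_trace (y : Y) (U : set Y) (C : set X) :
  nbhs y U -> CC C -> C y -> exists Q : set X,
    nbhs (y : X) Q /\ Q `&` C `<=` U.
Proof.
rewrite nbhsE => -[E [/= oE Ey] EU] CC_C Cy.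
have [Q oQ QE] := localization_trace_open oE CC_C.
exists Q; split; last by rewrite QE => z [/EU].
apply: open_nbhs_nbhs; split => //.
by have : (E `&` C) y by []; rewrite -QE => -[].
Qed.

(** * Bounded sets of the localized topology *)

Lemma localizing_bounded (C : set X) : CC C -> tvs_bounded (E := Y) C.
Proof.
move=> CC_C U U0; have C0 := localizing_zero CCloc CC_C.
have [Q [Q0 QU]] := localized_nbhs_trace U0 CC_C C0.
have /nbhs_ballP[e /= e0 eQ] := near0_scale_sub (CCcompact CC_C) Q0.
have eV0 : 0 < e^-1 by rewrite invr_gt0.
(* The summand [1] keeps [t^-1 *: y] in [C] by convexity; the summand [e^-1] makes [t^-1 < e], which
   puts it in [Q]. *)
exists (1 + e^-1); first exact: addr_gt0.
move=> t rt y Cy; have t1 : 1 < t by apply: lt_trans rt; rewrite ltrDl.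
have t0 : 0 < t by exact: lt_trans t1.
exists (t^-1 *: y); last by rewrite scalerA divff ?scale1r // gt_eqF.
apply: QU; split.
  apply: eQ => //; rewrite /ball /= sub0r normrN gtr0_norm ?invr_gt0 //.
  rewrite invf_plt ?posrE //; apply: lt_trans rt; exact: ltr_pwDl.
by apply: convex_scaleV => //; [exact: (localizing_convex CCloc)|exact: ltW].
Qed.

Lemma tvs_boundedS (E : tvsType R) (A B : set E) :
  A `<=` B -> tvs_bounded B -> tvs_bounded A.
Proof.
move=> AB bB U /bB[r r0 rB]; exists r => // t /rB.
exact: subset_trans.
Qed.

(* If no member of the family contains [B], pick [x k] in [B] outside of
   [(k + 1) C_k]: the points [x k / (k + 1)] meet each [C_m] in a finite set, so
   by [localized_openP] their complement is a neighbourhood of 0, and it does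
   not absorb [B]. *)
Lemma localized_bounded_sub (B : set Y) :
  tvs_bounded (E := Y) B -> exists2 C, CC C & B `<=` C.
Proof.
move=> bB; apply: contrapT => nB; have [C [CC_C CCE hC]] := localizing_sequence.
have ex_x k : exists x : X, B x /\ ~ C k (k.+1%:R^-1 *: x).
  apply: contrapT => nx; apply: nB.
  (* Otherwise [B] lies in the dilate of [C k] by [k.+1], hence in a member of the family. *)
  have [D CC_D sub] := localizing_affine CCloc 0 k.+1%:R (CC_C k).
  exists D => // x Bx; apply: sub; exists (k.+1%:R^-1 *: x).
    by apply: contrapT => nC; apply: nx; exists x.
  by rewrite scalerA divff ?pnatr_eq0 // scale1r add0r.
have {ex_x}[x xP] := choice ex_x.
pose f k : X := k.+1%:R^-1 *: x k.
have oF : open (~` range f : set Y).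
  apply/localized_openP => _ /CCE[m <-].
  (* For [k >= m] the point [f k] avoids [C k], hence also [C m], so only indices below [m]
     matter. *)
  exists (~` (f @` `I_m)).
    apply: closed_openC.
    apply: (accessible_finite_set_closed.1 (hausdorff_accessible hX)).
    exact: finite_image.
  apply/seteqP; split => y [nf Cy]; split => // -[k _ fy]; apply: nf.
    exists k => //=; rewrite ltnNge; apply/negP => /hC /(_ y Cy).
    by rewrite -fy; exact: (xP k).2.
  by exists k.
have nF : nbhs (0 : Y) (~` range f : set Y).
  apply: open_nbhs_nbhs; split => // -[k _ fk].
  by apply: (xP k).2; rewrite -/(f k) fk; exact: (localizing_zero CCloc).
have [r r0 rB] := bB _ nF.
(* This choice makes [k.+1] exceed [r], so it is an admissible dilation factor. *)
pose k := Num.truncn r.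
have rk : r < k.+1%:R by exact: truncnS_gt.
have [y nfy yx] := rB _ rk _ (xP k).1.
apply: nfy; exists k => //.
by rewrite /f -yx scalerA mulVf ?pnatr_eq0 // scale1r.
Qed.

(** * Cauchy sequences and sequential completeness *)

Lemma localizing_prefix (u : nat -> X) n :
  exists2 C, CC C & forall i, (i <= n)%N -> C (u i).
Proof.
have [C [CC_C CCE hC]] := localizing_sequence.
elim: n => [|n [_ /CCE[k <-] Ck]].
  have [D CC_D Du] := localizing_cover (u 0%N).
  by exists D => // i; rewrite leqn0 => /eqP ->.
have [_ /CCE[m <-] Cm] := localizing_cover (u n.+1).
exists (C (maxn k m)) => //.
move=> i; rewrite leq_eqVlt => /predU1P[->|/Ck].
  exact: hC (leq_maxr _ _) _ Cm.
exact: hC (leq_maxl _ _) _.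
Qed.

(** Terms up to some [N] lie in one bounded member of the family; later ones differ from [u N] by an
    element of [V], and [V + V] lies in [U]. *)
Lemma localized_cauchy_bounded (u : nat -> Y) :
  cauchy (u @ \oo) -> tvs_bounded (E := Y) (range u).
Proof.
move=> cu U U0; have [V [oV cV V0 VU]] := nbhs0_convex_split U0.
have nV : nbhs (0 : Y) V by exact: open_nbhs_nbhs.
have entV : entourage [set xy : Y * Y | V (xy.1 - xy.2)].
  by apply/localized_entourageE; exists V.
have [[P Q] /= [[N1 _ PN] [N2 _ QN]] PQ] := cu _ entV.
pose N := maxn N1 N2.
have uN n : (N <= n)%N -> V (u n - u N).
  move=> Nn; apply: (PQ (u n, u N)); split => /=.
    by apply: PN => /=; exact: leq_trans (leq_maxl _ _) Nn.
  by apply: QN => /=; exact: leq_maxr.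
have [C CC_C Cu] := localizing_prefix u N.
have [r r0 rC] := localizing_bounded CC_C nV.
exists (1 + r); first exact: addr_gt0.
move=> t rt _ [n _ <-].
have /rC Ct : r < t by apply: lt_trans rt; rewrite ltrDr.
have t1 : 1 < t by apply: lt_trans rt; rewrite ltrDl.
have t0 : 0 < t by exact: lt_trans t1.
have [nN|/ltnW Nn] := leqP n N.
  have [y Vy yu] := Ct _ (Cu _ nN); exists y => //.
  by rewrite -(addr0 y); exact: VU.
have [y Vy yu] := Ct _ (Cu _ (leqnn N)).
exists (t^-1 *: (u n - u N) + y).
  by apply: VU => //; apply: convex_scaleV => //; [exact: uN|exact: ltW].
by rewrite scalerDr scalerA divff ?gt_eqF // scale1r yu subrK.
Qed.

Lemma localized_sequentially_complete : sequentially_complete Y.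
Proof.
move=> u cu.
have [C CC_C uC] := localized_bounded_sub (localized_cauchy_bounded cu).
have FC : ((u : nat -> X) @ \oo) C by exists 0%N => // n _; apply: uC; exists n.
have [l [Cl cll]] := CCcompact CC_C _ FC.
(* Compactness gives a cluster point for the original topology; it is one for the localized topology
   too, as the sequence stays in [C]. *)
exists l; apply: cauchy_cluster_cvg => // A U uA lU.
have [Q [lQ QU]] := localized_nbhs_trace lU CC_C Cl.
have [y [[Ay Cy] Qy]] := cll _ _ (filterI uA FC) lQ.
by exists y; split => //; exact: QU.
Qed.

End localized.

Theorem theorem4p2 (R : realType) (X : tvsType R) (CC : set_system X)
    (X_hausdorff : hausdorff_space X)
    (CC_loc : localizing_family CC)
    (CC_count : nondecreasing_countable CC)
    (CC_compact : forall C, CC C -> compact C) :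
  [/\ localization CC =
        [set E : set X | forall C, CC C -> trace_open C (E `&` C)],
      forall E : set (localized CC_loc),
        (open E <-> forall C, CC C -> trace_open C (E `&` C)) /\
        (closed E <-> forall C, CC C -> trace_closed C (E `&` C)),
      forall B : set (localized CC_loc),
        tvs_bounded (E := localized CC_loc) B <-> exists2 C, CC C & B `<=` C &
      sequentially_complete (localized CC_loc)].
Proof.
split.
- exact: localization_compactE.
- by move=> E; split; [exact: localized_openP|exact: localized_closedP].
- move=> B; split; first exact: localized_bounded_sub.
  by move=> [C CC_C BC]; exact: tvs_boundedS BC (localizing_bounded _ CC_C).
- exact: localized_sequentially_complete.
Qed.
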